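(* Let $T$ and $B$ be lattice paths with steps $N=(0,1)$ and $E=(1,0)$ from the origin to a point $(x,y)\in\mathbb N^2$, with $T$ weakly above $B$, and let $k\ge 1$. Then the distribution of $(h_0,h_1,\dots,h_k)$ over $\mathcal P^k(T,B)$ is symmetric: for every permutation $\pi$ of $\{0,1,\dots,k\}$, $$\sum_{\mathbf P\in\mathcal P^k(T,B)}\prod_{i=0}^k z_i^{h_i(\mathbf P)}=\sum_{\mathbf P\in\mathcal P^k(T,B)}\prod_{i=0}^k z_i^{h_{\pi(i)}(\mathbf P)}.$$
   Context: $T$ weakly above $B$ means no point of $T$ is strictly below or strictly to the right of $B$. $\mathcal P(T,B)$ is the set of lattice paths with steps $N,E$ from the origin to $(x,y)$ lying weakly above $B$ and weakly below $T$. $\mathcal P^k(T,B)$ is the set of $k$-tuples $\mathbf P=(P_1,\dots,P_k)$ with each $P_i\in\mathcal P(T,B)$ and $P_i$ weakly above $P_{i+1}$ for $1\le i\le k-1$. With the convention $P_0=T$ and $P_{k+1}=B$, $h_i(\mathbf P)$ (for $0\le i\le k$) is the number of east steps on which $P_i$ and $P_{i+1}$ coincide. *)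

(* Defs.v *)
From HB Require Import structures.
From mathcomp Require Import all_boot.

Set Implicit Arguments.
Unset Strict Implicit.
Unset Printing Implicit Defensive.

Notation step := bool (only parsing).
Definition North : step := true.
Definition East : step := false.

(* The lattice point reached from the origin after the first j steps of w. *)
Definition point (w : seq step) (j : nat) : nat * nat :=
  (count_mem East (take j w), count_mem North (take j w)).

Definition points (w : seq step) : seq (nat * nat) :=
  [seq point w j | j <- iota 0 (size w).+1].

(* Being a subtype of a tuple type makes lpath x y a finite type; the length of
   a path from the origin to (x, y) is necessarily x + y. *)
Record lpath (x y : nat) := LPath {
  steps :> (x + y).-tuple step;
  _ : point steps (size steps) == (x, y)
}.

HB.instance Definition _ (x y : nat) := [isSub for @steps x y].
HB.instance Definition _ (x y : nat) := [Finite of lpath x y by <:].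

(* p lies below every point of w in its column.  This is meaningful only when w
   meets that column, which always holds for paths with the same endpoints;
   likewise for rows in strictly_right. *)
Definition strictly_below (w : seq step) (p : nat * nat) : bool :=
  all (fun q => (q.1 == p.1) ==> (p.2 < q.2)) (points w).

Definition strictly_right (w : seq step) (p : nat * nat) : bool :=
  all (fun q => (q.2 == p.2) ==> (q.1 < p.1)) (points w).

Definition weakly_above (x y : nat) : rel (lpath x y) := fun T B =>
  all (fun p => ~~ strictly_below B p && ~~ strictly_right B p) (points T).

Definition paths (x y : nat) (T B : lpath x y) : {set lpath x y} :=
  [set P | weakly_above P B & weakly_above T P].

Definition path_tuples (x y k : nat) (T B : lpath x y) :
    {set k.-tuple (lpath x y)} :=
  [set P : k.-tuple (lpath x y) |
    all (mem (paths T B)) P & sorted (@weakly_above x y) P].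

(* An east step is identified by its starting point. *)
Definition east_steps (w : seq step) : seq (nat * nat) :=
  [seq point w j | j <- iota 0 (size w) & nth North w j == East].

Definition common_east (v w : seq step) : nat :=
  count (mem (east_steps w)) (east_steps v).

(* P is indexed from 0 by the library but from 1 in the mathematics; prepending
   T and appending B makes the i-th entry P_i, with P_0 = T and P_(k+1) = B. *)
Definition bounded_seq (x y k : nat) (T B : lpath x y) (P : k.-tuple (lpath x y)) :
    seq (lpath x y) :=
  T :: rcons P B.

Definition h (x y k : nat) (T B : lpath x y) (P : k.-tuple (lpath x y))
    (i : nat) : nat :=
  common_east (nth T (bounded_seq T B P) i) (nth T (bounded_seq T B P) i.+1).

(* Main.v *)
(* A path is recorded by the weakly increasing sequence p_1 <= ... <= p_x of the
   heights of its east steps; "weakly above" becomes the pointwise order and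
   common east steps become equal entries.

   Let M_z be the matrix with entry z^(number of common east steps of P and Q)
   at (P, Q) when P is weakly above Q, and 0 otherwise.  The generating function
   is the (T, B) entry of M_(z_0) ... M_(z_k), so the theorem says that these
   matrices commute.  This is the case k = 1: the pair (number of j with
   p_j = t_j, number of j with p_j = b_j) is symmetric over all weakly
   increasing p with b_j <= p_j <= t_j.

   Write the indicator of p_j <= p_(j+1) as 1 - [p_j > p_(j+1)] and expand.  The
   sum becomes a signed sum of products over blocks i..j of strictly decreasing
   sequences p_i > ... > p_j.  As t and b are weakly increasing, the only
   constraints left in a block are p_i <= t_i and p_j >= b_j, and only the first
   entry can touch t and only the last one can touch b; exchanging the two
   endpoint weights therefore does not change the sum over a block. *)

Require Import Defs.
From mathcomp Require Import all_boot all_fingroup all_algebra.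
From mathcomp Require Import mpoly.
From mathcomp Require Import ring.

Set Implicit Arguments.
Unset Strict Implicit.
Unset Printing Implicit Defensive.

Import GRing.Theory.

(** * Paths encoded by the heights of their east steps *)

Fixpoint heights (n : nat) (w : seq bool) : seq nat :=
  if w is s :: w' then if s then heights n.+1 w' else n :: heights n w' else [::].

Lemma size_heights n w : size (heights n w) = count_mem East w.
Proof. by elim: w n => [|[] w IHw] n //=; rewrite IHw. Qed.

Lemma path_heights n w : path leq n (heights n w).
Proof.
elim: w n => [|[] w IHw] n //=; last by rewrite leqnn IHw.
by case: (heights _ _) (IHw n.+1) => //= m s /andP[/ltnW-> ->].
Qed.

Lemma heights_ge n w : all (leq n) (heights n w).
Proof. exact: (order_path_min leq_trans (path_heights n w)). Qed.

Lemma heights_le n w : all (geq (n + count_mem North w)) (heights n w).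
Proof.
elim: w n => [|[] w IHw] n //=.
  by rewrite add1n addnS -addSn; apply: IHw.
by rewrite add0n leq_addr IHw.
Qed.

Lemma heights_inj n v w :
  count_mem North v = count_mem North w -> heights n v = heights n w -> v = w.
Proof.
elim: v w n => [|[] v IHv] [|[] w] n //=; rewrite ?add0n ?add1n //.
- by case=> eqN /IHv->.
- move=> _ eqh; have := heights_ge n.+1 v.
  by rewrite eqh /= ltnn.
- move=> _ eqh; have := heights_ge n.+1 w.
  by rewrite -eqh /= ltnn.
- by move=> eqN [] /IHv->.
Qed.

Lemma heights_nseq n m w : heights n (nseq m North ++ w) = heights (n + m) w.
Proof. by elim: m n => [|m IHm] n; rewrite ?addn0 //= IHm addnS. Qed.

Fixpoint of_heights (y n : nat) (s : seq nat) : seq bool :=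
  if s is u :: s' then nseq (u - n) North ++ East :: of_heights y u s'
  else nseq (y - n) North.

Lemma of_heightsP y n s : path leq n s -> (n <= y)%N -> all (geq y) s ->
  [/\ heights n (of_heights y n s) = s,
      count_mem East (of_heights y n s) = size s
    & count_mem North (of_heights y n s) = (y - n)%N].
Proof.
elim: s n => [|u s IHs] n /=.
  move=> _ le_ny _; split; rewrite ?count_nseq ?mul0n ?mul1n //.
  by rewrite -[nseq _ _]cats0 heights_nseq.
case/andP=> le_nu path_s le_ny /andP[le_uy le_sy].
have [IH1 IH2 IH3] := IHs u path_s le_uy le_sy; split.
- by rewrite heights_nseq subnKC //= IH1.
- by rewrite count_cat count_nseq mul0n /= IH2.
- by rewrite count_cat count_nseq mul1n /= IH3 add0n addnC addnBA // subnK.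
Qed.

(** * The geometric order on paths as the pointwise order on heights *)

Lemma points_cons s w :
  points (s :: w) = (0, 0)%N ::
    [seq ((s == East) + p.1, (s == North) + p.2)%N | p <- points w].
Proof.
have iotaS : iota 0 (size w).+2 = 0%N :: map (addn 1) (iota 0 (size w).+1).
  by rewrite -iotaDl.
by rewrite /points iotaS map_cons -!map_comp.
Qed.

Lemma count_heights_lt n w v : (v <= n)%N -> count (gtn v) (heights n w) = 0%N.
Proof.
move=> le_vn; apply/eqP; rewrite -leqn0 leqNgt -has_count; apply/hasPn => u.
by move/(allP (heights_ge n w)) => /= le_nu; rewrite -leqNgt (leq_trans le_vn).
Qed.

(** In row [v] a path runs from the column counting its east steps below height [v] to the column
    counting those at height at most [v]. The starting height [n] is free for the induction. *)
Lemma mem_points n w c v :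
  ((c, v) \in [seq (p.1, n + p.2)%N | p <- points w]) =
  [&& n <= v <= n + count_mem North w,
      count (gtn v) (heights n w) <= c & c <= count (geq v) (heights n w)]%N.
Proof.
elim: w n c => [|s w IHw] n c.
  rewrite /= inE xpair_eqE /= !addn0 leqn0 -eqn_leq eq_sym andbC.
  by rewrite [v == n]eq_sym.
rewrite points_cons map_cons inE -map_comp xpair_eqE addn0.
case: s.
  have -> : [seq ((fun p => (p.1, (n + p.2)%N)) \o
      (fun p => ((true == East) + p.1, (true == North) + p.2)%N)) i | i <- points w] =
      [seq (p.1, n.+1 + p.2)%N | p <- points w].
    by apply: eq_map => p /=; rewrite add0n add1n addnS.
  rewrite IHw /= add1n addnS -addSn.
  have [->|ne_vn] := eqVneq v n; last by rewrite andbF /= ltn_neqAle eq_sym ne_vn.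
  rewrite ltnn orbF andbT leqnn addSn (leqW (leq_addr _ _)) count_heights_lt //=.
  rewrite -(eq_count (fun u => ltnS u n)) count_heights_lt //.
  by rewrite leqn0.
have -> : [seq ((fun p => (p.1, (n + p.2)%N)) \o
      (fun p => ((false == East) + p.1, (false == North) + p.2)%N)) i | i <- points w] =
      [seq (p.1.+1, p.2) | p <- [seq (p.1, n + p.2)%N | p <- points w]].
  by rewrite -map_comp; apply: eq_map => p.
have count0 : n = v -> count (gtn v) (heights n w) = 0.
  by move->; apply: count_heights_lt.
case: c => [|c].
  rewrite [X in _ || X](_ : _ = false) ?orbF /=; last by apply/mapP => -[[? ?]].
  rewrite add0n leqn0 addn_eq0 andbT.
  have [eq_vn|ne_vn] := eqVneq v n.
    by rewrite count0 // eq_vn ltnn leqnn leq_addr.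
  by case: (ltngtP n v) ne_vn => // _; rewrite ?andbF.
rewrite andFb orFb -[(c.+1, v)]/((fun p => (p.1.+1, p.2)) (c, v)).
rewrite mem_map => [|[? ?] [? ?] [-> ->] //]; rewrite IHw /= add0n.
have [_|//|eq_nv] /= := ltngtP n v; first by rewrite !add1n !ltnS.
by rewrite count0 // add1n ltnS.
Qed.

(** The entries at most [v] of a sorted sequence form a prefix. *)
Lemma nth_le_count s v j : sorted leq s -> j < size s ->
  (nth 0 s j <= v) = (j < count (geq v) s).
Proof.
elim: s j => [|u s IHs] [|j] //= path_s; rewrite ?ltnS => lt_js.
  have [le_uv|lt_vu] := leqP u v; rewrite ?add1n // add0n -has_count.
  apply/esym/hasPn => m /(allP (order_path_min leq_trans path_s)) /=.
  by rewrite -ltnNge; apply: leq_trans lt_vu.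
rewrite (IHs _ (path_sorted path_s) lt_js).
have [le_uv|lt_vu] := leqP u v; rewrite ?add1n ?ltnS // add0n.
have /eqP-> // : count (geq v) s == 0.
rewrite -leqn0 leqNgt -has_count; apply/hasPn => m.
move/(allP (order_path_min leq_trans path_s)) => /=.
by rewrite -ltnNge; apply: leq_trans lt_vu.
Qed.

Lemma all2_leq_count s t : sorted leq s -> sorted leq t -> size s = size t ->
  all2 leq s t <-> forall v, count (geq v) t <= count (geq v) s.
Proof.
move=> sort_s sort_t eq_sz; rewrite all2E eq_sz eqxx /=.
have -> : all [pred xy | xy.1 <= xy.2] (zip s t) <->
    forall j, j < size t -> nth 0 s j <= nth 0 t j.
  split=> [/(all_nthP (0, 0)) le_st j lt_jt | le_st].
    have := le_st j; rewrite size_zip eq_sz minnn nth_zip //; exact.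
  apply/(all_nthP (0, 0)) => j; rewrite size_zip eq_sz minnn nth_zip //.
  exact: le_st.
split=> [le_st v | le_cnt j lt_jt].
  case eq_m: (count (geq v) t) => [//|m].
  have lt_mt : m < size t by rewrite -eq_m count_size.
  rewrite -nth_le_count ?eq_sz //; apply: leq_trans (le_st m lt_mt) _.
  by rewrite nth_le_count // eq_m.
rewrite nth_le_count ?eq_sz //; apply: leq_trans (le_cnt _).
by rewrite -nth_le_count.
Qed.

Section Paths.

Variables x y : nat.
Implicit Types P Q T B : lpath x y.

Definition hts P := heights 0 P.

Lemma count_steps P : count_mem East P = x /\ count_mem North P = y.
Proof.
case: P => w end_w /=; have := end_w; rewrite {1}/point take_size xpair_eqE.
by case/andP => /eqP-> /eqP->.
Qed.

Lemma size_hts P : size (hts P) = x.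
Proof. by rewrite size_heights (proj1 (count_steps P)). Qed.

Lemma hts_sorted P : sorted leq (hts P).
Proof. exact: path_sorted (path_heights 0 P). Qed.

Lemma hts_le P : all (geq y) (hts P).
Proof. by have := heights_le 0 P; rewrite add0n (proj2 (count_steps P)). Qed.

Lemma hts_inj : injective hts.
Proof.
move=> P Q eq_h; do 2!apply: val_inj; apply: heights_inj eq_h.
by rewrite !(proj2 (count_steps _)).
Qed.

Lemma htsP (s : seq nat) :
  reflect (exists P, s = hts P) [&& size s == x, sorted leq s & all (geq y) s].
Proof.
apply: (iffP and3P) => [[/eqP size_s sort_s le_sy]|[P ->]]; last first.
  by rewrite size_hts hts_sorted hts_le eqxx.
have path_s : path leq 0 s by rewrite (path_sortedE leq_trans) sort_s andbT; apply/allP.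
have [hw eqE eqN] := of_heightsP path_s (leq0n y) le_sy.
have size_w : size (of_heights y 0 s) == x + y.
  rewrite -(count_predC (pred1 East)) eqE size_s (eq_count (a2 := pred1 North)) ?eqN ?subn0 //.
  by case.
have end_w : point (Tuple size_w) (size (Tuple size_w)) == (x, y).
  by rewrite /point take_size /= eqE eqN size_s subn0.
by exists (LPath end_w); rewrite /hts /= hw.
Qed.

Lemma mem_pointsE P c v :
  ((c, v) \in points P) =
  [&& v <= y, count (gtn v) (hts P) <= c & c <= count (geq v) (hts P)].
Proof.
have := mem_points 0 P c v; rewrite add0n (proj2 (count_steps P)) => <-.
by rewrite -[in LHS](map_id (points P)); congr (_ \in _); apply: eq_map => -[].
Qed.

Lemma weakly_aboveE T B : weakly_above T B = all2 leq (hts B) (hts T).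
Proof.
apply/idP/idP => [/allP above | le_BT].
  apply/all2_leq_count; rewrite ?hts_sorted ?size_hts // => v.
  wlog le_vy : v / v <= y.
    have [le_vy|lt_yv] := leqP v y => [|_]; first exact.
    suff -> : count (geq v) (hts B) = x by rewrite -[X in _ <= X](size_hts T) count_size.
    rewrite -[RHS](size_hts B); apply/eqP; rewrite -all_count.
    by apply: sub_all (hts_le B) => u /= /leq_trans->//; apply: ltnW.
  (* The rightmost point of [T] in row [v]. Since it is not strictly below [B], the path [B] has at
     least as many east steps at height at most [v]. *)
  have : (count (geq v) (hts T), v) \in points T.
    rewrite mem_pointsE le_vy leqnn andbT; apply: sub_count => u; exact: ltnW.
  case/above/andP=> /allPn[[c v']]; rewrite mem_pointsE => /and3P[_ _ le_c].
  rewrite negb_imply -leqNgt /= => /andP[/eqP eq_c le_v'v] _.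
  rewrite -eq_c; apply: leq_trans le_c _.
  by apply: sub_count => u /= /leq_trans->.
have {}le_BT := proj1 (all2_leq_count (hts_sorted B) (hts_sorted T) _) le_BT.
have {}le_BT v : count (geq v) (hts T) <= count (geq v) (hts B).
  by apply: le_BT; rewrite !size_hts.
apply/allP => -[c v]; rewrite mem_pointsE => /and3P[le_vy _ le_cT].
have le_cB := leq_trans le_cT (le_BT v).
apply/andP; split; apply/allPn.
  (* The witness is the lowest point of [B] in column [c], found as the least height by which [B]
     has made [c] east steps. *)
  have ex_v : exists v, c <= count (geq v) (hts B) by exists v.
  have [v' le_cv' min_v'] := ex_minnP ex_v.
  have le_v'v := min_v' _ le_cB.
  exists (c, v'); last by rewrite negb_imply eqxx -leqNgt.
  rewrite mem_pointsE (leq_trans le_v'v) //= le_cv' andbT.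
  case: v' min_v' {le_cv' le_v'v} => [|v'] min_v'.
    by rewrite (@eq_count _ _ pred0) ?count_pred0.
  have /contraNN := min_v' v'; rewrite ltnn => /(_ isT); rewrite -ltnNge.
  exact: ltnW.
exists (count (geq v) (hts B), v); last by rewrite negb_imply eqxx -leqNgt.
by rewrite mem_pointsE le_vy leqnn andbT; apply: sub_count => u; apply: ltnW.
Qed.

End Paths.

(** * Common east steps as equal heights *)

Definition coincidences (s t : seq nat) : nat :=
  count (fun p => p.1 == p.2) (zip s t).

Lemma coincidencesC s t : coincidences s t = coincidences t s.
Proof.
rewrite /coincidences; elim: s t => [|u s IHs] [|v t] //=.
by rewrite eq_sym IHs.
Qed.

Lemma east_steps_cons s w :
  east_steps (s :: w) = nseq (s == East) (0, 0) ++
    [seq ((s == East) + p.1, (s == North) + p.2) | p <- east_steps w].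
Proof.
have iotaS : iota 0 (size w).+1 = 0 :: map (addn 1) (iota 0 (size w)).
  by rewrite -iotaDl.
rewrite /east_steps [size _]/= iotaS /= filter_map.
by case: s; rewrite /= -!map_comp.
Qed.

Lemma east_stepsE c n w :
  [seq (c + p.1, n + p.2) | p <- east_steps w] =
  zip (iota c (size (heights n w))) (heights n w).
Proof.
elim: w c n => [|[] w IHw] c n //; rewrite east_steps_cons /=.
  by rewrite -IHw -map_comp; apply: eq_map => p /=; rewrite add1n addnS.
rewrite !addn0 -IHw -map_comp; congr (_ :: _).
by apply: eq_map => p /=; rewrite add1n addnS.
Qed.

(** The first coordinates are distinct columns, so an east step can only match the step of the other
    path in its own column. *)
Lemma count_mem_zip_iota c s t : size s = size t ->
  count (mem (zip (iota c (size t)) t)) (zip (iota c (size s)) s) = coincidences s t.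
Proof.
elim: s t c => [|u s IHs] [|v t] c //= [eq_sz].
have notin a r : (c, a) \in zip (iota c.+1 (size r)) r = false.
  apply/negP => /(map_f fst); rewrite -/(unzip1 _) unzip1_zip ?size_iota //.
  by rewrite mem_iota ltnn.
rewrite inE notin orbF xpair_eqE eqxx /=; congr (_ + _).
apply: etrans (IHs t c.+1 eq_sz); apply: eq_in_count => -[d a] in_s /=.
rewrite inE xpair_eqE; case: eqP => // eq_dc; move: in_s.
by rewrite eq_dc notin.
Qed.

Lemma common_eastE x y (P Q : lpath x y) :
  common_east P Q = coincidences (hts P) (hts Q).
Proof.
have stepsE (S : lpath x y) : east_steps S = zip (iota 0 (size (hts S))) (hts S).
  by rewrite -east_stepsE -[LHS]map_id; apply: eq_map => -[].
by rewrite /common_east !stepsE count_mem_zip_iota // !size_hts.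
Qed.

(** * Weakly increasing sequences between two bounds *)

Fixpoint box_seqs (L : seq (nat * nat)) (v : nat) : seq (seq nat) :=
  if L is p :: L' then
    [seq u :: s | u <- [seq u <- index_iota p.1 p.2.+1 | v <= u], s <- box_seqs L' u]
  else [:: [::]].

Lemma mem_box_seqs L v s : (s \in box_seqs L v) =
  path leq v s && all2 (fun p u => p.1 <= u <= p.2) L s.
Proof.
elim: L v s => [|p L IHL] v s /=; first by case: s => //= u s; rewrite andbF.
apply/allpairsPdep/idP => [[u [r [in_u in_r ->]]] | ].
  move: in_u in_r; rewrite mem_filter mem_index_iota ltnS IHL /=.
  by case/andP=> -> -> /andP[-> ->].
case: s => [|u s] //=.
case/andP=> /andP[le_vu path_s] /andP[in_u in_s].
by exists u, s; rewrite mem_filter mem_index_iota ltnS IHL le_vu in_u path_s in_s.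
Qed.

Lemma box_seqs_uniq L v : uniq (box_seqs L v).
Proof.
elim: L v => [|p L IHL] v //=; apply: allpairs_uniq_dep => //.
- exact/filter_uniq/iota_uniq.
- by move=> [u s] [u' s'] _ _ /= [<- <-].
Qed.

(** * Inclusion-exclusion over descents, and symmetry of the two weights *)

Local Open Scope ring_scope.

(* The number of chains v > u_1 > ... > u_m > b; for m = 0 it is [b < v]. *)
Fixpoint chains (b m v : nat) : nat :=
  if m is m'.+1 then (\sum_(0 <= u < v) chains b m' u)%N else (b < v)%N.

Lemma chains_le b m v : (v <= b)%N -> chains b m v = 0%N.
Proof.
elim: m v => [|m IHm] v le_vb /=; first by rewrite ltnNge le_vb.
by rewrite big_nat big1 // => u /andP[_ lt_uv]; apply/IHm/ltnW/(leq_trans lt_uv).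
Qed.

Section Weighted.

Variable R : comPzRingType.
Implicit Types (z w : R) (L : seq (nat * nat)).

(** The pair [p] is (b_j, t_j): [z] marks contact with the upper path and [w] with the lower one;
    both count when b_j = t_j. *)
Definition touch z w (p : nat * nat) u : R :=
  (if u == p.2 then z else 1) * (if u == p.1 then w else 1).

Fixpoint box_sum z w L v : R :=
  if L is p :: L' then
    \sum_(p.1 <= u < p.2.+1 | (v <= u)%N) touch z w p u * box_sum z w L' u
  else 1.

(* Chains v > u_0 > ... > u_m >= b, weighted by w when u_m = b. *)
Definition wchains w b m v : R := (chains b m.+1 v)%:R + w * (chains b m v)%:R.

(* Inclusion-exclusion terms for descents v > u_0 > u_1 > ... below a given height
   v: the sign is that of the length, j entries precede the head of L, and what
   follows the descent is unconstrained by it. *)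
Fixpoint descent_sum z w j L v : R :=
  if L is p :: L' then
    wchains w p.1 j v * box_sum z w L' 0 - descent_sum z w j.+1 L' v
  else 0.

Lemma sum_wchains w b m v :
  \sum_(0 <= u < v) wchains w b m u = wchains w b m.+1 v.
Proof. by rewrite /wchains big_split /= -mulr_sumr -!natr_sum. Qed.

Lemma sum_descent_sum z w j L v :
  \sum_(0 <= u < v) descent_sum z w j L u = descent_sum z w j.+1 L v.
Proof.
elim: L j => [|p L IHL] j /=; first by rewrite big1.
by rewrite sumrB IHL -mulr_suml sum_wchains.
Qed.

Lemma descent_sum_le z w j L v :
  all (fun p => (v <= p.1)%N) L -> descent_sum z w j L v = 0.
Proof.
elim: L j => [|p L IHL] j //= /andP[le_vp le_vL].
by rewrite IHL // /wchains !chains_le // mulr0 addr0 mul0r subr0.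
Qed.

(** With c_i = [chains b i v], both sides expand to zw c_m + (z + w) c_(m+1) + c_(m+2). *)
Lemma wchains_sym z w b m v :
  z * wchains w b m v + wchains w b m.+1 v =
  w * wchains z b m v + wchains z b m.+1 v.
Proof. rewrite /wchains; ring. Qed.

Lemma wchains0 w b v :
  \sum_(b <= u < v) (if u == b then w else 1) = wchains w b 0 v.
Proof.
have [le_vb|lt_bv] := leqP v b.
  by rewrite big_geq // /wchains !chains_le // mulr0 addr0.
rewrite big_ltn // eqxx addrC /wchains [chains b 0 v]/= lt_bv mulr1; congr (_ + _).
rewrite [chains b 1 v]/= natr_sum; apply/esym.
rewrite (big_cat_nat (n := b.+1)) //= big_nat big1 ?add0r.
  rewrite !big_nat; apply: eq_bigr => u /andP[lt_bu _].
  by rewrite lt_bu gtn_eqF.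
by move=> u; rewrite /= ltnS ltnNge => ->.
Qed.

(** Interior values have weight 1, and the two ends contribute z + w, or zw when they coincide. *)
Lemma sum_touch_sym z w b t :
  \sum_(b <= u < t.+1) touch z w (b, t) u = \sum_(b <= u < t.+1) touch w z (b, t) u.
Proof.
have [lt_tb|le_bt] := ltnP t b; first by rewrite !big_geq.
have [->|ne_bt] := eqVneq b t.
  by rewrite !big_nat1 /touch /= !eqxx mulrC.
have lt_bt : (b < t)%N by rewrite ltn_neqAle ne_bt.
rewrite !(big_ltn (m := b)) // !big_nat_recr //= /touch /= !eqxx.
rewrite (negPf ne_bt) eq_sym (negPf ne_bt) !mul1r !mulr1.
rewrite addrCA [RHS]addrCA [z + w]addrC; congr (_ + _).
rewrite !big_nat; apply: eq_bigr => u /andP[lt_bu lt_ut].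
by rewrite (ltn_eqF lt_ut) (gtn_eqF lt_bu).
Qed.

Definition dominated (p q : nat * nat) := (p.1 <= q.1)%N && (p.2 <= q.2)%N.

(** All later lower bounds are at least [b], so [descent_sum] vanishes at every [u <= b]. The range
    may therefore start at 0, and the [w]-weight at [u = b] multiplies zero. *)
Lemma sum_touch_descent z w b t L (s : nat) :
    all (dominated (b, t)) L -> (s <= t.+1)%N ->
  \sum_(b <= u < s) touch z w (b, t) u * descent_sum z w 0 L u =
  \sum_(0 <= u < s) (if u == t then z else 1) * descent_sum z w 0 L u.
Proof.
move=> domL le_st.
have dsum0 u : (u <= b)%N -> descent_sum z w 0 L u = 0.
  move=> le_ub; apply: descent_sum_le; apply: sub_all domL => q /andP[/= le_bq _].
  exact: leq_trans le_bq.
have [le_sb|lt_bs] := leqP s b.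
  rewrite big_geq // big_nat big1 // => u /andP[_ lt_us].
  by rewrite dsum0 ?mulr0 // (leq_trans (ltnW lt_us)).
apply/esym; rewrite (big_cat_nat (n := b)) //=; last exact: ltnW.
rewrite big_nat big1 ?add0r => [|u /= /ltnW/dsum0->]; last by rewrite mulr0.
rewrite !big_nat; apply: eq_bigr => u /andP[le_bu _]; rewrite /touch /=.
by have [->|ne_ub] := eqVneq u b; rewrite ?mulr1 // dsum0 // !mulr0.
Qed.

(** The difference collects the heads [u < v]. By induction each carries the unbounded sum of the
    tail minus a [descent_sum], which reproduces the recursion of [descent_sum]. As [v] is at most
    every upper bound, no such head touches its upper bound, so none is weighted by [z]. *)
Lemma box_sumE z w L v :
    pairwise dominated L -> all (fun p => (v <= p.2)%N) L ->
  box_sum z w L v = box_sum z w L 0 - descent_sum z w 0 L v.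
Proof.
elim: L v => [|[b t] L IHL] v /=; first by rewrite subr0.
move=> /andP[domL pwL] /andP[le_vt _].
apply/eqP; rewrite eq_sym subr_eq eq_sym; apply/eqP.
rewrite [RHS](bigID (fun u => v <= u)%N) /=; congr (_ + _).
have le_vt1 : (v <= t.+1)%N by apply: leqW.
rewrite -wchains0 -sum_descent_sum.
have -> : \sum_(b <= u < t.+1 | ~~ (v <= u)%N) touch z w (b, t) u * box_sum z w L u
   = \sum_(b <= u < v) touch z w (b, t) u * box_sum z w L u.
  rewrite [RHS](big_nat_widen _ _ t.+1) //; apply: eq_bigl => u.
  by rewrite -ltnNge.
have -> : \sum_(0 <= u < v) descent_sum z w 0 L u =
   \sum_(b <= u < v) touch z w (b, t) u * descent_sum z w 0 L u.
  rewrite sum_touch_descent // !big_nat; apply: eq_bigr => u /andP[_ lt_uv].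
  by rewrite ltn_eqF ?mul1r // (leq_trans lt_uv).
rewrite mulr_suml -sumrB !big_nat; apply: eq_bigr => u /andP[_ lt_uv].
rewrite (IHL u) //; last first.
  apply: sub_all domL => q /andP[_ /= le_tq].
  exact: leq_trans (leq_trans (ltnW lt_uv) le_vt) le_tq.
by rewrite mulrBr /touch /= (ltn_eqF (leq_trans lt_uv le_vt)) mul1r.
Qed.

(* The summand for the imposed descent u > u_1 > ... has z-weight only at u = t,
   since u_1, ... are below u <= t; hence the asymmetric bracket, which
   [wchains_sym] shows to be symmetric. *)
Lemma box_sum_cons z w b t L :
    pairwise dominated ((b, t) :: L) ->
  box_sum z w ((b, t) :: L) 0 =
  (\sum_(b <= u < t.+1) touch z w (b, t) u) * box_sum z w L 0
  - (z * descent_sum z w 0 L t + descent_sum z w 1 L t).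
Proof.
rewrite [box_sum z w (_ :: _) 0]/= pairwise_cons => /andP[domL pwL].
have -> : z * descent_sum z w 0 L t + descent_sum z w 1 L t =
   \sum_(b <= u < t.+1) touch z w (b, t) u * descent_sum z w 0 L u.
  rewrite sum_touch_descent // big_nat_recr //= eqxx addrC; congr (_ + _).
  rewrite -sum_descent_sum !big_nat; apply: eq_bigr => u /andP[_ lt_ut].
  by rewrite ltn_eqF ?mul1r.
rewrite mulr_suml -sumrB !big_nat; apply: eq_bigr => u /andP[_ lt_ut].
rewrite box_sumE ?mulrBr //; apply: sub_all domL => q /andP[_ /=].
exact: leq_trans.
Qed.

Lemma box_sum_sym z w L :
  pairwise dominated L -> box_sum z w L 0 = box_sum w z L 0.
Proof.
(* The induction also carries the symmetry of the bracket in [box_sum_cons]. It is needed for every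
   [j], which grows along the list, and for every [v], since the top [t] of the preceding box is
   substituted for it. *)
suff: pairwise dominated L ->
    box_sum z w L 0 = box_sum w z L 0 /\
    forall j v, z * descent_sum z w j L v + descent_sum z w j.+1 L v =
                w * descent_sum w z j L v + descent_sum w z j.+1 L v.
  by move=> H /H[].
elim: L => [|[b t] L IHL pwL]; first by split=> // j v /=; rewrite !mulr0.
have [bsym dsym] := IHL (proj2 (andP pwL)); split.
  by rewrite !box_sum_cons // sum_touch_sym bsym dsym.
move=> j v /=.
rewrite !mulrBr !mulrA.
rewrite addrACA -mulrDl -opprD dsym wchains_sym bsym.
by rewrite mulrDl opprD addrACA.
Qed.

End Weighted.

Lemma box_sum_seqs (R : comPzRingType) (z w : R) L v :
  box_sum z w L v = \sum_(s <- box_seqs L v)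
    z ^+ coincidences (unzip2 L) s * w ^+ coincidences (unzip1 L) s.
Proof.
elim: L v => [|p L IHL] v /=; first by rewrite big_seq1 mulr1.
rewrite big_allpairs_dep big_filter; apply: eq_bigr => u _.
rewrite IHL mulr_sumr; apply: eq_bigr => s _.
rewrite /touch /coincidences /= [p.2 == u]eq_sym [p.1 == u]eq_sym !exprD mulrACA.
by do 2 case: (u == _).
Qed.

Lemma all2_box b t s : size b = size s -> size t = size s ->
  all2 (fun p u => p.1 <= u <= p.2)%N (zip b t) s = all2 leq b s && all2 leq s t.
Proof.
elim: s b t => [|u s IHs] [|v b] [|v' t] //= [eq_b] [eq_t].
by rewrite IHs // andbACA.
Qed.

Lemma perm_foldr (S : eqType) (A : Type) (f : S -> A -> A) (a : A) s1 s2 :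
  (forall i j b, f i (f j b) = f j (f i b)) ->
  perm_eq s1 s2 -> foldr f a s1 = foldr f a s2.
Proof.
move=> fC; elim: s1 s2 => [|i s1 IHs] s2 perm12; first by
  move: perm12; rewrite perm_sym => /perm_nilP->.
have : i \in s2 by rewrite -(perm_mem perm12) mem_head.
move=> /splitPr def_s2; case: def_s2 perm12 => r1 r2.
rewrite perm_sym perm_catC /= perm_cons perm_catC perm_sym => /IHs /= ->.
by elim: r1 => //= j r1 <-; rewrite fC.
Qed.

Lemma mem_zip (S1 S2 : eqType) (a : S1) (b : S2) s t :
  (a, b) \in zip s t -> (a \in s) && (b \in t).
Proof.
elim: s t => [|c s IHs] [|d t] //=; rewrite !inE xpair_eqE.
by case/orP=> [/andP[-> ->] //|/IHs/andP[-> ->]]; rewrite !orbT.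
Qed.

(** * Commuting transfer operators on functions of paths *)

Section Transfer.

Variables (R : comPzRingType) (x y : nat).
Implicit Types (P Q T B : lpath x y) (z w : R) (f : {ffun lpath x y -> R}).

(** The matrix M_z acting on a column vector [f]. *)
Definition transfer z f : {ffun lpath x y -> R} :=
  [ffun P => \sum_(Q | weakly_above P Q) z ^+ common_east P Q * f Q].

Lemma sum_between_box z w T B :
  \sum_(Q | weakly_above T Q && weakly_above Q B)
    z ^+ common_east T Q * w ^+ common_east Q B =
  box_sum z w (zip (hts B) (hts T)) 0.
Proof.
rewrite box_sum_seqs unzip1_zip ?unzip2_zip ?size_hts //.
pose between := [seq Q <- enum {: lpath x y} | weakly_above T Q && weakly_above Q B].
transitivity (\sum_(s <- map (@hts x y) between)
    z ^+ coincidences (hts T) s * w ^+ coincidences (hts B) s).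
  rewrite big_map big_filter big_enum_cond; apply: eq_bigr => Q _.
  by rewrite !common_eastE [coincidences (hts Q) _]coincidencesC.
apply: perm_big; apply: uniq_perm; last move=> s.
- by rewrite (map_inj_uniq (@hts_inj x y)) filter_uniq ?enum_uniq.
- exact: box_seqs_uniq.
rewrite mem_box_seqs; apply/mapP/idP => [[Q] | /andP[path_s in_s]].
  rewrite mem_filter !weakly_aboveE => /andP[/andP[le_QT le_BQ] _] ->.
  rewrite all2_box ?size_hts // le_QT le_BQ andbT.
  by rewrite (path_sortedE leq_trans) hts_sorted !andbT; apply/allP.
have size_s : size s = x.
  by move: in_s; rewrite all2E => /andP[/eqP<- _]; rewrite size_zip !size_hts minnn.
move: in_s; rewrite all2_box ?size_hts // => /andP[le_Bs le_sT].
have /htsP[Q eq_s] : [&& size s == x, sorted leq s & all (geq y) s].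
  rewrite size_s eqxx (path_sorted path_s) /=.
  apply/(all_nthP 0%N) => j; rewrite size_s => lt_jx.
  have lt_jT : (j < size (hts T))%N by rewrite size_hts.
  apply: leq_trans (all_nthP 0%N (hts_le T) j lt_jT).
  move: le_sT; rewrite all2E => /andP[_ /(all_nthP (0, 0)%N) /(_ j)].
  by rewrite size_zip size_hts size_s minnn nth_zip ?size_hts //; apply.
by exists Q => //; rewrite mem_filter mem_enum !weakly_aboveE -eq_s le_sT le_Bs.
Qed.

Lemma weakly_above_trans : transitive (@weakly_above x y).
Proof.
move=> Q P S; rewrite !weakly_aboveE !all2E !size_hts eqxx /=.
move=> /(all_nthP (0, 0)%N) le_QP /(all_nthP (0, 0)%N) le_SQ.
apply/(all_nthP (0, 0)%N) => j; rewrite size_zip !size_hts minnn => lt_jx.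
have := le_SQ j; have := le_QP j; rewrite !size_zip !size_hts minnn.
rewrite !nth_zip ?size_hts //= => /(_ lt_jx) le1 /(_ lt_jx) le2.
exact: leq_trans le2 le1.
Qed.

Lemma sum_between_sym z w T B :
  \sum_(Q | weakly_above T Q && weakly_above Q B)
    z ^+ common_east T Q * w ^+ common_east Q B =
  \sum_(Q | weakly_above T Q && weakly_above Q B)
    w ^+ common_east T Q * z ^+ common_east Q B.
Proof.
rewrite !sum_between_box; apply: box_sum_sym.
(* Both height sequences increase weakly, so each pair (b_j, t_j) is dominated by all later ones. *)
have := hts_sorted B; have := hts_sorted T.
rewrite !(sorted_pairwise leq_trans).
elim: (hts B) (hts T) => [|b s IHs] [|t r] //= /andP[le_t pw_r] /andP[le_b pw_s].
rewrite IHs // andbT; apply/allP => -[b' t'] in_sr.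
have [in_s in_r] : b' \in s /\ t' \in r.
  by apply/andP/mem_zip.
by rewrite /dominated /= (allP le_b) // (allP le_t).
Qed.

(** Grouping by the final path [S] turns each matrix entry of the product into a sum over the middle
    path, which is the case k = 1. *)
Lemma transferC z w f : transfer z (transfer w f) = transfer w (transfer z f).
Proof.
have expand z' w' P : transfer z' (transfer w' f) P =
    \sum_S (\sum_(Q | weakly_above P Q && weakly_above Q S)
      z' ^+ common_east P Q * w' ^+ common_east Q S) * f S.
  rewrite ffunE.
  under eq_bigr => Q _ do rewrite ffunE mulr_sumr.
  rewrite (exchange_big_dep predT) //=; apply: eq_bigr => S _.
  by rewrite mulr_suml; apply: eq_bigr => Q _; rewrite mulrA.
by apply/ffunP => P; rewrite !expand; apply: eq_bigr => S _; rewrite sum_between_sym.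
Qed.

(** Summing over the first path last peels off the operator of weight z_0, and the indicator of [B]
    pins the final path. All indices are in range, so any default [D] will do. *)
Lemma sum_tuples k (z : 'I_k.+1 -> R) D T B :
  \sum_(P : k.-tuple (lpath x y) | path (@weakly_above x y) T (rcons P B))
    \prod_(i < k.+1) z i ^+ common_east (nth D (T :: rcons P B) i) (nth D (rcons P B) i) =
  foldr transfer [ffun Q => (Q == B)%:R] (codom z) T.
Proof.
elim: k z T => [|k IHk] z T; rewrite codomE enum_ordSl /= ffunE.
  have -> : enum 'I_0 = [::] by apply/nilP; rewrite /nilp size_enum_ord.
  rewrite /= big_mkcond (big_pred1 [tuple]) => [|P]; last by apply/esym/eqP; apply: tuple0.
  rewrite /= andbT big_ord1 /= big_mkcond [RHS](bigD1 B) //= big1 ?addr0.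
    by rewrite ffunE eqxx mulr1.
  by move=> Q ne_QB; rewrite ffunE (negPf ne_QB) mulr0 if_same.
rewrite -map_comp -codomE.
rewrite (reindex (fun p : lpath x y * k.-tuple (lpath x y) =>
  [tuple of p.1 :: p.2])) /=; last first.
  exists (fun P : k.+1.-tuple _ => (thead P, [tuple of behead P])) => [[Q P] _|P _].
    by congr (_, _); apply: val_inj.
  by rewrite /= -tuple_eta.
rewrite -(pair_big_dep (weakly_above T)
  (fun Q (P : k.-tuple (lpath x y)) => path (@weakly_above x y) Q (rcons P B))
  (fun Q (P : k.-tuple (lpath x y)) => \prod_(i < k.+2)
    z i ^+ common_east (nth D (T :: Q :: rcons P B) i)
                       (nth D (Q :: rcons P B) i))) /=.
apply: eq_bigr => Q _; rewrite -IHk mulr_sumr; apply: eq_bigr => P _.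
by rewrite [LHS]big_ord_recl.
Qed.

(** By transitivity both sides compare all pairs in the chain from [T] through [P] to [B]; the
    hypothesis supplies the pair of [T] and [B]. *)
Lemma path_tuplesE k T B (P : k.-tuple (lpath x y)) : weakly_above T B ->
  (P \in path_tuples k T B) = path (@weakly_above x y) T (rcons P B).
Proof.
move=> le_BT; rewrite inE.
rewrite -[RHS]/(sorted _ (T :: rcons P B)) !(sorted_pairwise weakly_above_trans) /=.
rewrite all_rcons pairwise_rcons le_BT /= !andbA; congr (_ && _).
rewrite -all_predI; apply: eq_all => Q; rewrite /= inE andbC //.
Qed.

End Transfer.

Theorem theorem2p3 (x y : nat) (T B : lpath x y) (hTB : weakly_above T B)
    (k : nat) (hk : (1 <= k)%N) (pi : {perm 'I_k.+1}) :
  \sum_(P in path_tuples k T B) \prod_(i < k.+1) 'X_i ^+ h T B P i =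
  \sum_(P in path_tuples k T B) \prod_(i < k.+1) 'X_i ^+ h T B P (pi i)
  :> {mpoly int[k.+1]}.
Proof.
pose gf (z : 'I_k.+1 -> {mpoly int[k.+1]}) :=
  \sum_(P in path_tuples k T B) \prod_(i < k.+1) z i ^+ h T B P i.
have gfE z : gf z = foldr (@transfer _ x y) [ffun Q => (Q == B)%:R] (codom z) T.
  rewrite -(sum_tuples z T); apply: eq_big => P; first by rewrite path_tuplesE.
  by [].
(* Permuting the statistics by [pi] amounts to permuting the variables by its inverse, hence to
   reordering the operators. *)
transitivity (gf (fun i => 'X_((pi^-1)%g i))); last first.
  apply: eq_bigr => P _; rewrite (reindex_inj (@perm_inj _ pi)) /=.
  by apply: eq_bigr => i _; rewrite permK.
rewrite -/(gf (fun i => 'X_i)) !gfE; congr (fun_of_fin _ T); apply: perm_foldr.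
  exact: transferC.
rewrite !codomE (map_comp (fun i => 'X_i) (pi^-1)%g); apply: perm_map.
apply: uniq_perm; rewrite ?(map_inj_uniq (@perm_inj _ _)) ?enum_uniq // => i.
by rewrite mem_enum -[X in X \in map _ _](permK pi) map_f ?mem_enum.
Qed.
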